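(* $\mathsf{IKt}2(\Diamond,\Diamond^{\bullet})$ (and hence all its extensions) proves: (1) $\Diamond A \leftrightarrow \forall X(\Box(A\to\blacksquare X)\to X)$; (2) $\Diamond^{\bullet} A\leftrightarrow\forall X(\blacksquare(A\to\Box X)\to X)$, where $X$ is not free in $A$.
   Context: Here $\Diamond$ and the backward diamond $\Diamond^{\bullet}$ are primitive unary operators added to the language $A ::= P \mid X \mid A\to B\mid \Box A\mid\blacksquare A\mid\forall XA$. $\mathsf{IKt}2(\Diamond,\Diamond^{\bullet})$ is axiomatised by: second-order intuitionistic propositional logic (axioms $A\to B\to A$; $(A\to B\to C)\to(A\to B)\to A\to C$; $\forall X(A\to B)\to\forall XA\to\forall XB$; $A\to\forall XA$ for $X\notin\mathrm{fv}(A)$; full comprehension $\forall XA\to A[C/X]$ for any formula $C$; modus ponens; generalisation: from $A[P/X]$ infer $\forall XA$ for $P$ a fresh propositional symbol); normality: $\Box(A\to B)\to\Box A\to\Box B$, $\Box(A\to B)\to\Diamond A\to\Diamond B$, $\blacksquare(A\to B)\to\blacksquare A\to\blacksquare B$, $\blacksquare(A\to B)\to\Diamond^{\bullet}A\to\Diamond^{\bullet}B$, and necessitation rules for $\Box$ and $\blacksquare$; adjunction axioms $\Diamond^{\bullet}\Box A\to A$, $A\to\Box\Diamond^{\bullet}A$, $\Diamond\blacksquare A\to A$, $A\to\blacksquare\Diamond A$. $A\leftrightarrow B$ abbreviates the (second-order encoded) conjunction of $A\to B$ and $B\to A$. *)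

(* Defs.v *)
(* Second-order tense formulas over countably many propositional symbols.
   Second-order variables are de Bruijn indices: [Var n] refers to the n-th
   enclosing [All], counted from the inside, and an index pointing past all
   enclosing binders is a free variable.  Formulas are thus taken up to renaming
   of bound variables.  A formula placed under a binder [All] whose variable X is
   not free in it is written with [shift]. *)
Inductive form : Type :=
| Sym (p : nat)
| Var (n : nat)
| Imp (A B : form)
| Box (A : form)
| BBox (A : form)
| Dia (A : form)
| BDia (A : form)
| All (A : form).

Declare Scope form_scope.
Delimit Scope form_scope with form.
Bind Scope form_scope with form.

Notation "A ~> B" := (Imp A B) (at level 60, right associativity) : form_scope.
Notation "□ A" := (Box A) (at level 45, right associativity) : form_scope.
Notation "■ A" := (BBox A) (at level 45, right associativity) : form_scope.
Notation "◇ A" := (Dia A) (at level 45, right associativity) : form_scope.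
Notation "◆ A" := (BDia A) (at level 45, right associativity) : form_scope.
Notation "∀₂ A" := (All A) (at level 45, right associativity) : form_scope.

Local Open Scope form_scope.

Definition up_ren (r : nat -> nat) (n : nat) : nat :=
  match n with 0 => 0 | S m => S (r m) end.

Fixpoint rename (r : nat -> nat) (A : form) : form :=
  match A with
  | Sym p => Sym p
  | Var n => Var (r n)
  | A ~> B => rename r A ~> rename r B
  | □ A => □ rename r A
  | ■ A => ■ rename r A
  | ◇ A => ◇ rename r A
  | ◆ A => ◆ rename r A
  | ∀₂ A => ∀₂ rename (up_ren r) A
  end.

Definition shift (A : form) : form := rename S A.

Definition up (s : nat -> form) (n : nat) : form :=
  match n with 0 => Var 0 | S m => shift (s m) end.

(* Capture-avoiding simultaneous substitution. *)
Fixpoint fsubst (s : nat -> form) (A : form) : form :=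
  match A with
  | Sym p => Sym p
  | Var n => s n
  | A ~> B => fsubst s A ~> fsubst s B
  | □ A => □ fsubst s A
  | ■ A => ■ fsubst s A
  | ◇ A => ◇ fsubst s A
  | ◆ A => ◆ fsubst s A
  | ∀₂ A => ∀₂ fsubst (up s) A
  end.

(* A[C/X], where A is the body of a quantifier [∀₂ A] binding X. *)
Definition inst (C A : form) : form :=
  fsubst (fun n => match n with 0 => C | S m => Var m end) A.

Fixpoint occurs (p : nat) (A : form) : Prop :=
  match A with
  | Sym q => p = q
  | Var _ => False
  | A ~> B => occurs p A \/ occurs p B
  | □ A | ■ A | ◇ A | ◆ A | ∀₂ A => occurs p A
  end.

(* ∀X((A → B → X) → X) with X not free in A, B. *)
Definition Conj (A B : form) : form :=
  ∀₂ ((shift A ~> shift B ~> Var 0) ~> Var 0).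

Definition Iff (A B : form) : form := Conj (A ~> B) (B ~> A).

Notation "A <~> B" := (Iff A B) (at level 65, no associativity) : form_scope.

Inductive IKt2 : form -> Prop :=
| ax_K A B : IKt2 (A ~> B ~> A)
| ax_S A B C : IKt2 ((A ~> B ~> C) ~> (A ~> B) ~> A ~> C)
| ax_all_dist A B : IKt2 (∀₂ (A ~> B) ~> ∀₂ A ~> ∀₂ B)
| ax_all_vac A : IKt2 (A ~> ∀₂ shift A)
| ax_compr A C : IKt2 (∀₂ A ~> inst C A)
| rule_mp A B : IKt2 (A ~> B) -> IKt2 A -> IKt2 B
| rule_gen A p : ~ occurs p A -> IKt2 (inst (Sym p) A) -> IKt2 (∀₂ A)
| ax_box_box A B : IKt2 (□ (A ~> B) ~> □ A ~> □ B)
| ax_box_dia A B : IKt2 (□ (A ~> B) ~> ◇ A ~> ◇ B)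
| ax_bbox_bbox A B : IKt2 (■ (A ~> B) ~> ■ A ~> ■ B)
| ax_bbox_bdia A B : IKt2 (■ (A ~> B) ~> ◆ A ~> ◆ B)
| rule_nec_box A : IKt2 A -> IKt2 (□ A)
| rule_nec_bbox A : IKt2 A -> IKt2 (■ A)
| ax_bdia_box A : IKt2 (◆ □ A ~> A)
| ax_box_bdia A : IKt2 (A ~> □ ◆ A)
| ax_dia_bbox A : IKt2 (◇ ■ A ~> A)
| ax_bbox_dia A : IKt2 (A ~> ■ ◇ A).

(* An extension is given by its set of theorems; it need not be obtained by
   adding axioms only, nor be closed under any particular rule. *)
Definition extends_IKt2 (L : form -> Prop) : Prop :=
  forall A, IKt2 A -> L A.

(* Main.v *)
(* The forward implication at a propositional symbol P is
   □(A → ■P) → ◇A → ◇■P followed by the counit ◇■P → P, and P is then generalised.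
   Conversely, instantiating X with ◇A makes the premise □(A → ■X) the
   necessitation of the unit A → ■◇A.  The backward case is dual. *)
From Stdlib Require Import Lia.
Require Import Defs.

Local Open Scope form_scope.

(** Stated for arbitrary [s] and [r] because the induction must pass under [∀₂], where they become
    [up s] and [up_ren r]; the cancellation hypothesis survives this lifting. *)
Lemma fsubst_rename_cancel (A : form) :
  forall (s : nat -> form) (r : nat -> nat),
    (forall n, s (r n) = Var n) -> fsubst s (rename r A) = A.
Proof.
  induction A; intros s r Hsr; simpl; auto; f_equal; auto.
  apply IHA; intros [|n]; simpl; [reflexivity|].
  now rewrite Hsr.
Qed.

Lemma inst_shift (C A : form) : inst C (shift A) = A.
Proof. now apply fsubst_rename_cancel. Qed.

(** A bound is the right induction statement: bounds for the two sides of an implication combine,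
    whereas one fresh symbol for each side would not. *)
Lemma occurs_bounded (A : form) : exists N, forall p, occurs p A -> p <= N.
Proof.
  induction A as [q| |A [N HN] B [M HM]|A IH|A IH|A IH|A IH|A IH]; simpl; auto.
  - exists q; lia.
  - exists 0; tauto.
  - exists (N + M); intros p [H|H]; [apply HN in H|apply HM in H]; lia.
Qed.

Lemma exists_fresh (A : form) : exists p, ~ occurs p A.
Proof.
  destruct (occurs_bounded A) as [N HN].
  exists (S N); intros H; apply HN in H; lia.
Qed.

(** Hides the choice of a fresh symbol, so that later arguments may treat [p] as arbitrary. *)
Lemma IKt2_gen (A : form) : (forall p, IKt2 (inst (Sym p) A)) -> IKt2 (∀₂ A).
Proof.
  intros H; destruct (exists_fresh A) as [p Hp].
  now apply rule_gen with p.
Qed.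

Lemma IKt2_weaken (A B : form) : IKt2 B -> IKt2 (A ~> B).
Proof. apply rule_mp, ax_K. Qed.

Lemma IKt2_mp_under (A B C : form) :
  IKt2 (A ~> B ~> C) -> IKt2 (A ~> B) -> IKt2 (A ~> C).
Proof. intros H; apply rule_mp; revert H; apply rule_mp, ax_S. Qed.

Lemma IKt2_trans (A B C : form) :
  IKt2 (A ~> B) -> IKt2 (B ~> C) -> IKt2 (A ~> C).
Proof.
  intros HAB HBC; apply IKt2_mp_under with B; [now apply IKt2_weaken|exact HAB].
Qed.

(** The combinator term S K K. *)
Lemma IKt2_id (A : form) : IKt2 (A ~> A).
Proof. apply IKt2_mp_under with (A ~> A); apply ax_K. Qed.

Lemma IKt2_swap (A B C : form) : IKt2 (A ~> B ~> C) -> IKt2 (B ~> A ~> C).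
Proof.
  intros H; apply IKt2_trans with (A ~> B); [apply ax_K|].
  revert H; apply rule_mp, ax_S.
Qed.

Lemma IKt2_compose_under (A B C D : form) :
  IKt2 (A ~> B ~> C) -> IKt2 (C ~> D) -> IKt2 (A ~> B ~> D).
Proof.
  intros HC HD; apply IKt2_trans with (B ~> C); [exact HC|].
  apply rule_mp with (B ~> C ~> D); [apply ax_S|now apply IKt2_weaken].
Qed.

Lemma IKt2_apply (A B : form) : IKt2 A -> IKt2 ((A ~> B) ~> B).
Proof.
  intros HA; apply IKt2_mp_under with A; [apply IKt2_id|now apply IKt2_weaken].
Qed.

Lemma IKt2_all_intro (A B : form) :
  (forall p, IKt2 (A ~> inst (Sym p) B)) -> IKt2 (A ~> ∀₂ B).
Proof.
  intros H; apply IKt2_trans with (∀₂ shift A); [apply ax_all_vac|].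
  apply rule_mp with (∀₂ (shift A ~> B)); [apply ax_all_dist|].
  apply IKt2_gen; intros p.
  (* [inst] computes through connectives, and on a shifted formula it cancels the shift. *)
  change (IKt2 (inst (Sym p) (shift A) ~> inst (Sym p) B)).
  now rewrite inst_shift.
Qed.

Lemma IKt2_iff (A B : form) :
  IKt2 (A ~> B) -> IKt2 (B ~> A) -> IKt2 (A <~> B).
Proof.
  intros HAB HBA; apply IKt2_gen; intros p.
  change (IKt2 ((inst (Sym p) (shift (A ~> B)) ~>
                 inst (Sym p) (shift (B ~> A)) ~> Sym p) ~> Sym p)).
  rewrite !inst_shift.
  (* The encoded conjunction is eliminated into [Sym p] by feeding it first [A ~> B], then
     [B ~> A]. *)
  apply IKt2_trans with ((B ~> A) ~> Sym p); now apply IKt2_apply.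
Qed.

Lemma dia_iff_all (A : form) :
  IKt2 (◇ A <~> ∀₂ (□ (shift A ~> ■ Var 0) ~> Var 0)).
Proof.
  apply IKt2_iff.
  - apply IKt2_all_intro; intros p.
    change (IKt2 (◇ A ~> □ (inst (Sym p) (shift A) ~> ■ Sym p) ~> Sym p)).
    (* With the boxed premise in front, the goal has the shape of [ax_box_dia] up to the counit. *)
    rewrite inst_shift; apply IKt2_swap.
    apply IKt2_compose_under with (◇ ■ Sym p); [apply ax_box_dia|apply ax_dia_bbox].
  - eapply IKt2_trans; [apply ax_compr with (C := ◇ A)|].
    change (IKt2 ((□ (inst (◇ A) (shift A) ~> ■ ◇ A) ~> ◇ A) ~> ◇ A)).
    rewrite inst_shift; apply IKt2_apply, rule_nec_box, ax_bbox_dia.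
Qed.

(** The adjunction of [◆] and [□] takes the place of that of [◇] and [■], with counit [ax_bdia_box]
    and unit [ax_box_bdia]. *)
Lemma bdia_iff_all (A : form) :
  IKt2 (◆ A <~> ∀₂ (■ (shift A ~> □ Var 0) ~> Var 0)).
Proof.
  apply IKt2_iff.
  - apply IKt2_all_intro; intros p.
    change (IKt2 (◆ A ~> ■ (inst (Sym p) (shift A) ~> □ Sym p) ~> Sym p)).
    rewrite inst_shift; apply IKt2_swap.
    apply IKt2_compose_under with (◆ □ Sym p); [apply ax_bbox_bdia|apply ax_bdia_box].
  - eapply IKt2_trans; [apply ax_compr with (C := ◆ A)|].
    change (IKt2 ((■ (inst (◆ A) (shift A) ~> □ ◆ A) ~> ◆ A) ~> ◆ A)).
    rewrite inst_shift; apply IKt2_apply, rule_nec_bbox, ax_box_bdia.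
Qed.

Theorem theorem2p7 :
  (forall A : form,
     IKt2 (◇ A <~> ∀₂ (□ (shift A ~> ■ Var 0) ~> Var 0)) /\
     IKt2 (◆ A <~> ∀₂ (■ (shift A ~> □ Var 0) ~> Var 0))) /\
  (forall (L : form -> Prop) (A : form),
     extends_IKt2 L ->
     L (◇ A <~> ∀₂ (□ (shift A ~> ■ Var 0) ~> Var 0))%form /\
     L (◆ A <~> ∀₂ (■ (shift A ~> □ Var 0) ~> Var 0))%form).
Proof.
  split.
  - intros A; split; [apply dia_iff_all|apply bdia_iff_all].
  - intros L A HL; split; apply HL; [apply dia_iff_all|apply bdia_iff_all].
Qed.
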